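(* Let $G$ be a connected cograph. Then either $\mu(G)=\mu_{\rm t}(G)$, or $\mu(G)=\mu_{\rm d}(G)=n(G)-1$ and $\mu_{\rm t}(G)=\mu_{\rm o}(G)=n(G)-2$.
   Context: A cograph is a graph with no induced path on four vertices; $n(G)$ is the order of $G$. For a connected graph $G$ and $X\subseteq V(G)$, two vertices are $X$-visible if there is a shortest path between them whose internal vertices are not in $X$. $X$ is: a mutual-visibility set if every two vertices of $X$ are $X$-visible; an outer mutual-visibility set if moreover every $x\in X$ and $y\notin X$ are $X$-visible; a dual mutual-visibility set if every two vertices of $X$ and every two vertices of $V(G)\setminus X$ are $X$-visible; a total mutual-visibility set if every two vertices of $G$ are $X$-visible. $\mu,\mu_{\rm o},\mu_{\rm d},\mu_{\rm t}$ denote the respective maximum cardinalities. *)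

(* Defs.v *)
From HB Require Import structures.
From mathcomp Require Import all_boot.
From mathcomp Require Import boolp.

Set Implicit Arguments.
Unset Strict Implicit.
Unset Printing Implicit Defensive.

Record sgraph := SGraph {
  vertex :> finType;
  adj : rel vertex;
  adj_sym : symmetric adj;
  adj_irr : irreflexive adj
}.

Definition graph_order (G : sgraph) : nat := #|G|.

Definition connected (G : sgraph) : Prop :=
  0 < graph_order G /\ forall x y : G, connect (@adj G) x y.

Definition has_induced_path (n : nat) (G : sgraph) : Prop :=
  exists f : 'I_n -> G, injective f /\
    forall i j : 'I_n, adj (f i) (f j) = (i.+1 == j) || (j.+1 == i).

Definition cograph (G : sgraph) : Prop := ~ has_induced_path 4 G.

Section Visibility.
Variable G : sgraph.
Implicit Types (x y : G) (p q : seq G) (X : {set G}).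

(* A walk is its starting point x together with the list p of the vertices
   that follow; its length is size p. *)
Definition walk x y p : Prop := path (@adj G) x p /\ last x p = y.

Definition shortest_path x y p : Prop :=
  walk x y p /\ forall q, walk x y q -> size p <= size q.

(* x :: p without its first and last entries *)
Definition internal x p : seq G := behead (belast x p).

Definition visible X x y : Prop :=
  exists p, shortest_path x y p /\ forall z, z \in internal x p -> z \notin X.

Definition mutual_visibility X : Prop :=
  forall x y, x \in X -> y \in X -> visible X x y.

Definition outer_mutual_visibility X : Prop :=
  mutual_visibility X /\
  forall x y, x \in X -> y \notin X -> visible X x y.

Definition dual_mutual_visibility X : Prop :=
  mutual_visibility X /\
  forall x y, x \notin X -> y \notin X -> visible X x y.

Definition total_mutual_visibility X : Prop :=
  forall x y, visible X x y.

End Visibility.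

(* The empty set satisfies each of the four conditions when G is connected,
   so the value 0 of an empty \max is not used there. *)
Definition mu (G : sgraph) : nat :=
  \max_(X : {set G} | `[< mutual_visibility X >]) #|X|.

Definition mu_o (G : sgraph) : nat :=
  \max_(X : {set G} | `[< outer_mutual_visibility X >]) #|X|.

Definition mu_d (G : sgraph) : nat :=
  \max_(X : {set G} | `[< dual_mutual_visibility X >]) #|X|.

Definition mu_t (G : sgraph) : nat :=
  \max_(X : {set G} | `[< total_mutual_visibility X >]) #|X|.

(* Main.v *)
Require Import Defs.
From HB Require Import structures.
From mathcomp Require Import all_boot.
From mathcomp Require Import boolp.
From mathcomp Require Import zify.

Set Implicit Arguments.
Unset Strict Implicit.
Unset Printing Implicit Defensive.

(** A connected cograph with an edge is the join of two nonempty parts.  Given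
    [a] and [b] in the two parts, any two distinct non-adjacent vertices have
    [a] or [b] as a common neighbour; hence the diameter is at most 2 and the
    complement of [{a, b}] is a total mutual-visibility set, so that
    [n - 2 <= mu_t <= mu_o <= mu <= n].  A mutual-visibility set that misses no
    vertex is total; one that misses a single vertex is dual, and it is total as
    soon as it is outer. *)

Lemma cograph_P4 (G : sgraph) (w x y z : G) : cograph G ->
  adj w x -> adj x y -> adj y z -> ~~ adj w y -> ~~ adj x z -> adj w z.
Proof.
move=> hco wx xy yz /negbTE nwy /negbTE nxz; apply/negPn/negP => /negbTE nwz.
apply: hco; exists (tnth [tuple w; x; y; z]).
have adjE (i j : 'I_4) : adj (tnth [tuple w; x; y; z] i)
    (tnth [tuple w; x; y; z] j) = (i.+1 == j) || (j.+1 == i).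
  rewrite !(tnth_nth w).
  case: i => [[|[|[|[|i]]]] Hi] //; case: j => [[|[|[|[|j]]]] Hj] //=;
  by rewrite ?adj_irr // ?wx ?xy ?yz ?nwy ?nxz ?nwz // adj_sym
    ?wx ?xy ?yz ?nwy ?nxz ?nwz.
split=> // i j eq_ij; apply: val_inj.
(* Injectivity comes from the adjacency pattern alone: the four vertices of the path have pairwise
   distinct neighbourhoods, so equal images force equal indices. *)
have nbr (k : 'I_4) : (i.+1 == k) || (k.+1 == i) = (j.+1 == k) || (k.+1 == j).
  by rewrite -!adjE eq_ij.
have := (nbr ord0, nbr (inord 1), nbr (inord 2), nbr ord_max).
rewrite /= !inordK //.
by case: i {eq_ij nbr} => [[|[|[|[|i]]]] Hi] //;
   case: j => [[|[|[|[|j]]]] Hj] //= [[[]]].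
Qed.

(** Irreflexivity of [adj] makes the parts disjoint; once they cover all vertices, they present [G]
    as a join. *)
Definition complete_pair (G : sgraph) (A B : {set G}) : Prop :=
  [/\ A != set0, B != set0 & {in A & B, forall a b, adj a b}].

(* If [v] can be added to neither part, each part splits into its neighbours and
   its non-neighbours of [v], and P4-freeness makes the splitting complete; so
   the neighbours of [v] are complete to [v] and its non-neighbours. *)
Lemma complete_pair_extend (G : sgraph) (A B : {set G}) (u v : G) :
  cograph G -> complete_pair A B -> u \in A :|: B -> adj v u ->
  exists C D : {set G}, complete_pair C D /\ C :|: D = v |: (A :|: B).
Proof.
move=> hco [A0 B0 AB] uAB vu.
have [/forall_inP vB|/forall_inPn[b bB nvb]] := boolP [forall b in B, adj v b].
  exists (v |: A), B; split; last by rewrite setUA.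
  split=> //; first by apply/set0Pn; exists v; rewrite setU11.
  by move=> x y /setU1P[->|xA] yB; [apply: vB|apply: AB].
have [/forall_inP vA|/forall_inPn[a aA nva]] := boolP [forall a in A, adj v a].
  exists A, (v |: B); split; last by rewrite setUCA.
  split=> //; first by apply/set0Pn; exists v; rewrite setU11.
  by move=> x y xA /setU1P[->|yB]; [rewrite adj_sym vA|apply: AB].
(* If [x] and [y] were non-adjacent, then [v], [x], [d], [y] in this order would force [adj v y] by
   [cograph_P4]. The vertex [d] will be [b] for two vertices of [A], and [a] for two vertices of
   [B]. *)
have split_part (C D : {set G}) d x y : {in C & D, forall c d, adj c d} ->
    d \in D -> ~~ adj v d -> x \in C -> y \in C -> adj v x -> ~~ adj v y ->
    adj x y.
  move=> CD dD nvd xC yC vx nvy; apply: contraNT nvy => nxy.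
  by apply: (cograph_P4 hco vx _ _ nvd nxy); [|rewrite adj_sym]; apply: CD.
have BA : {in B & A, forall b a, adj b a} by move=> y x yB xA; rewrite adj_sym AB.
exists [set x in A :|: B | adj v x], (v |: [set x in A :|: B | ~~ adj v x]).
split; last first.
  apply/setP=> x; rewrite !inE.
  by case: (x == v); case: (adj v x); case: (x \in A); case: (x \in B).
split.
- by apply/set0Pn; exists u; rewrite inE uAB.
- by apply/set0Pn; exists v; rewrite setU11.
move=> x y /setIdP[xAB vx] /setU1P[->|/setIdP[yAB nvy]]; first by rewrite adj_sym.
case/setUP: xAB => xP; case/setUP: yAB => yP.
- exact: (split_part A B b).
- exact: AB.
- exact: BA.
- exact: (split_part B A a).
Qed.

Lemma connected_cut_edge (G : sgraph) (S : {set G}) :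
  connected G -> S != set0 -> S != setT ->
  exists u v : G, [/\ u \in S, v \notin S & adj v u].
Proof.
move=> [_ conn] /set0Pn[s sS] ST.
have [t tS] : exists t, t \notin S.
  by apply/existsP; apply: contraNT ST => /existsPn H; apply/eqP/setP=> x;
     rewrite inE; apply/negPn/H.
have [/existsP[u /existsP[v /and3P[uS vS vu]]]|H] :=
    boolP [exists u, exists v, [&& u \in S, v \notin S & adj v u]].
  by exists u, v.
have clS : closed (@adj G) (mem S).
  apply: (intro_closed (sym_connect_sym (@adj_sym G))) => x y xy xS.
  apply: contraNT H => yS; apply/existsP; exists x; apply/existsP; exists y.
  by rewrite xS yS adj_sym.
by have := closed_connect clS (conn s t); rewrite /= sS (negbTE tS).
Qed.

(** Starting from the edge [x y], connectedness always supplies an uncovered vertex with a covered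
    neighbour, and [complete_pair_extend] absorbs it; the induction bounds the number of uncovered
    vertices. *)
Lemma connected_cograph_join (G : sgraph) (x y : G) :
  connected G -> cograph G -> adj x y ->
  exists A B : {set G}, complete_pair A B /\ A :|: B = setT.
Proof.
move=> hconn hco xy.
suff grow n (A B : {set G}) : complete_pair A B -> #|~: (A :|: B)| <= n ->
    exists C D : {set G}, complete_pair C D /\ C :|: D = setT.
  apply: (grow _ [set x] [set y]) (leqnn _).
  split.
  - by apply/set0Pn; exists x; rewrite set11.
  - by apply/set0Pn; exists y; rewrite set11.
  - by move=> a b /set1P-> /set1P->.
elim: n A B => [|n IHn] A B cAB.
  by rewrite leqn0 cards_eq0 -setCT (inj_eq (@setC_inj G)) => /eqP ABT; exists A, B.
have [ABT _|ABT] := eqVneq (A :|: B) setT; first by exists A, B.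
have AB0 : A :|: B != set0 by case: cAB => A0 _ _; rewrite setU_eq0 (negbTE A0).
have [u [v [uS vS vu]]] := connected_cut_edge hconn AB0 ABT.
have [C [D [cCD CDE]]] := complete_pair_extend hco cAB uS vu.
move=> le_n; apply: (IHn C D cCD); rewrite CDE.
have := cardsC (v |: (A :|: B)); have := cardsC (A :|: B).
by rewrite cardsU1 vS; lia.
Qed.

Lemma connected_cograph_hubs (G : sgraph) : connected G -> cograph G ->
  exists a b : G, forall x y : G, [\/ x = y, adj x y |
    exists2 z, z \in [set a; b] & adj x z && adj z y].
Proof.
move=> hconn hco.
have [/existsP[u /existsP[v uv]]|noedge] :=
  boolP [exists u : G, exists v : G, adj u v]; last first.
  (* Without edges, connectedness leaves a single vertex, which serves as both hubs. *)
  have [/card_gt0P[a _] conn] := hconn; exists a, a => x y.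
  have /connectP[[|z p] /= xp ->] := conn x y; first by constructor 1.
  case/andP: xp => xz _; case/negP: noedge.
  by apply/existsP; exists x; apply/existsP; exists z.
have [A [B [[/set0Pn[a aA] /set0Pn[b bB] AB] ABT]]] :=
  connected_cograph_join hconn hco uv.
exists a, b => x y.
have /setUP xAB : x \in A :|: B by rewrite ABT inE.
have /setUP yAB : y \in A :|: B by rewrite ABT inE.
case: xAB yAB => [xA|xB] [yA|yB].
- by constructor 3; exists b; rewrite ?set22 // (AB x b) //= adj_sym AB.
- by constructor 2; rewrite AB.
- by constructor 2; rewrite adj_sym AB.
- by constructor 3; exists a; rewrite ?set21 // (AB a y) // andbT adj_sym AB.
Qed.

Definition diameter_le2 (G : sgraph) : Prop :=
  forall x y : G, [\/ x = y, adj x y | exists z, adj x z && adj z y].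

(** Shortest paths have length at most 2, so an internal vertex occurs only between distinct
    non-adjacent vertices, and it is then a common neighbour. *)
Lemma visible_diameter_le2 (G : sgraph) (X : {set G}) (x y : G) :
  diameter_le2 G ->
  visible X x y <->
  [\/ x = y, adj x y | exists2 z, z \notin X & adj x z && adj z y].
Proof.
move=> diam; split=> [[p [[[xp lp] minp] avoid]]|].
  have size_p : size p <= 2.
    have [xy|xy|[z /andP[xz zy]]] := diam x y.
    - by apply: (leq_trans (minp [::] _)).
    - by apply: (leq_trans (minp [:: y] _)); rewrite //; split; rewrite //= xy.
    - by apply: (minp [:: z; y]); split; rewrite //= xz zy.
  case: p xp lp avoid size_p {minp} => [|z [|t [|]]] //=.
  - by move=> _ ->; constructor 1.
  - by move=> /andP[xz _] <-; constructor 2.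
  - move=> /and3P[xz zt _] <- avoid _; constructor 3; exists z.
      by apply: avoid; rewrite /internal /= inE.
    by rewrite xz zt.
have [->|nxy] := eqVneq x y.
  by exists [::]; split=> //; split.
have [xy|nadj] := boolP (adj x y).
  exists [:: y]; split=> //; split; first by split; rewrite //= xy.
  by case=> [[_ /= xy']|//]; rewrite xy' eqxx in nxy.
case=> [xy|//|[z zX /andP[xz zy]]]; first by rewrite xy eqxx in nxy.
exists [:: z; y]; split.
  split; first by split; rewrite //= xz zy.
  case=> [[_ /= xy']|t [[/andP[xt _] /= ty]|//]]; first by rewrite xy' eqxx in nxy.
  by rewrite -ty xt in nadj.
by move=> t; rewrite /internal /= inE => /eqP->.
Qed.

(** The outer condition speaks only of pairs whose first vertex lies in the set; this gives the
    reverse order. *)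
Lemma visible_sym (G : sgraph) (X : {set G}) (x y : G) :
  diameter_le2 G -> visible X x y -> visible X y x.
Proof.
move=> diam /(visible_diameter_le2 _ _ _ diam) H.
apply/(visible_diameter_le2 _ _ _ diam); case: H => [->|xy|[z zX /andP[xz zy]]].
- by constructor 1.
- by constructor 2; rewrite adj_sym.
- by constructor 3; exists z; rewrite // adj_sym zy adj_sym.
Qed.

Section Maxima.
Variables (G : sgraph) (P : {set G} -> Prop).
Local Notation maxP := (\max_(X : {set G} | `[< P X >]) #|X|).

Lemma leq_card_max (X : {set G}) : P X -> #|X| <= maxP.
Proof. by move=> PX; apply: (bigmax_sup X) => //; apply/asboolP. Qed.

Lemma max_card_attained : P set0 -> exists2 X : {set G}, P X & #|X| = maxP.
Proof.
move=> P0; have : 0 < #|[pred X : {set G} | `[< P X >]]|.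
  by apply/card_gt0P; exists set0; apply/asboolP.
case/(eq_bigmax_cond (fun X : {set G} => #|X|)) => X /asboolP PX ->.
by exists X.
Qed.

Lemma max_card_le (Q : {set G} -> Prop) : (forall X, P X -> Q X) ->
  maxP <= \max_(X : {set G} | `[< Q X >]) #|X|.
Proof.
move=> PQ; apply/bigmax_leqP => X /asboolP PX.
by apply: (bigmax_sup X) => //; apply/asboolP/PQ.
Qed.

End Maxima.

Lemma card_succ_setC1 (T : finType) (X : {set T}) :
  #|X| + 1 = #|T| -> exists c, X = ~: [set c].
Proof.
have := cardsC X => eT eX; have /eqP/cards1P[c Xc] : #|~: X| = 1 by lia.
by exists c; rewrite -Xc setCK.
Qed.

Theorem theorem4p7 (G : sgraph) (hconn : connected G) (hco : cograph G) :
  mu G = mu_t G \/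
  [/\ mu G + 1 = graph_order G, mu_d G + 1 = graph_order G,
      mu_t G + 2 = graph_order G & mu_o G + 2 = graph_order G].
Proof.
have [a [b hubs]] := connected_cograph_hubs hconn hco.
have diam : diameter_le2 G.
  move=> x y; case: (hubs x y) => [|xy|[z _ xzy]]; first by constructor 1.
    by constructor 2.
  by constructor 3; exists z.
have visxx X (x : G) : visible X x x.
  by apply/(visible_diameter_le2 _ _ _ diam); constructor 1.
have t_ge : graph_order G <= mu_t G + 2.
  have : #|~: [set a; b]| <= mu_t G.
    apply: leq_card_max => x y; apply/(visible_diameter_le2 _ _ _ diam).
    case: (hubs x y) => [|xy|[z zab xzy]]; first by constructor 1.
      by constructor 2.
    by constructor 3; exists z; rewrite ?inE ?negbK -?in_set2.
  (* The hubs may coincide; at most two vertices are removed in either case. *)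
  have := cardsC [set a; b]; rewrite cards2 /graph_order; lia.
have t_le_o : mu_t G <= mu_o G.
  by apply: max_card_le => X totX; split=> x y _ _; apply: totX.
have o_le : mu_o G <= mu G by apply: max_card_le => X [].
have d_le : mu_d G <= mu G by apply: max_card_le => X [].
have mut0 : mutual_visibility (set0 : {set G}) by move=> x y; rewrite inE.
have [X mutX cardX] := max_card_attained mut0; rewrite -/(mu G) in cardX.
have mu_le : mu G <= graph_order G by rewrite -cardX max_card.
have [mu_n|mu_lt] := eqVneq (mu G) (graph_order G).
  have XT : X = setT.
    by apply/eqP; rewrite eqEcard subsetT cardsT cardX mu_n /=.
  left; apply/eqP; rewrite eqn_leq (leq_trans t_le_o o_le) andbT -cardX.
  by apply: leq_card_max => x y; apply: mutX; rewrite XT inE.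
have [t_lt|] := ltnP (mu_t G) (mu G); last by left; lia.
(* Now [mu_t G < mu G < graph_order G], and [t_ge] leaves only the values [n - 2] and [n - 1] for
   [mu_t G] and [mu G]. *)
right; have mu_n1 : mu G + 1 = graph_order G by lia.
have [c Xc] : exists c, X = ~: [set c] by apply: card_succ_setC1; rewrite cardX.
(* Only [c] lies outside [X], so the extra dual condition reduces to the pair [c], [c]. *)
have d_ge : mu G <= mu_d G.
  rewrite -cardX; apply: leq_card_max; split=> // x y.
  by rewrite Xc !inE !negbK => /eqP-> /eqP->.
have out0 : outer_mutual_visibility (set0 : {set G}).
  by split=> // x y; rewrite inE.
have [Y [mutY outY] cardY] := max_card_attained out0.
rewrite -/(mu_o G) in cardY.
(* Otherwise [Y] misses a single vertex [d]; the outer condition handles every pair except [d], [d],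
   so [Y] is total, against [mu_t G < mu G]. Hence [mu_o G] is squeezed to [n - 2]. *)
have o_lt : mu_o G < mu G.
  rewrite ltn_neqAle o_le andbT; apply: contraTneq t_lt => o_mu.
  have [d Yd] : exists d, Y = ~: [set d].
    by apply: card_succ_setC1; rewrite cardY o_mu.
  rewrite -leqNgt -o_mu -cardY; apply: leq_card_max => x y.
  have [xY|xY] := boolP (x \in Y); have [yY|yY] := boolP (y \in Y).
  - exact: mutY.
  - exact: outY.
  - by apply: visible_sym => //; apply: outY.
  - by move: xY yY; rewrite Yd !inE !negbK => /eqP-> /eqP->.
by split=> //; lia.
Qed.
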